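(* For every $k\ge1$ and $n\ge0$, $\mathcal D_{k+1}(n)=\eta_{2k}(n)$, where $\mathcal D_{k+1}(n)$ is the total number of $(k+1)$-marked Durfee symbols of $n$ and $$\eta_{2k}(n)=\sum_{m\in\mathbb Z}\binom{m+k-1}{2k}N(m;n).$$
   Context: For an integer $x$ and $j\ge0$, $\binom{x}{j}=x(x-1)\cdots(x-j+1)/j!$. A partition is a finite nonincreasing sequence $\lambda=(\lambda_1,\dots,\lambda_r)$ of positive integers (possibly empty); $l(\lambda)=r$, $|\lambda|=\sum\lambda_i$, $\lambda_1$ the largest part. For integers $m$ and $n\ge0$, $N(m;n)$ is the number of partitions $\lambda$ of $n$ with $\lambda_1-l(\lambda)=m$ (the empty partition of $0$ having rank $0$). Let $k\ge1$. A $k$-marked Durfee symbol of $n$ is an array $\eta=\begin{pmatrix}\alpha^k,&\dots,&\alpha^1\\ \beta^k,&\dots,&\beta^1\end{pmatrix}_D$ consisting of an integer $D\ge0$ and $2k$ partitions $\alpha^i,\beta^i$ with $\sum_{i=1}^k(|\alpha^i|+|\beta^i|)+D^2=n$, such that: (1) $\alpha^i$ is nonempty for $1\le i<k$; (2) for $1\le i<k$ every part of $\beta^i$ is $\le\alpha^i_1$, and for $2\le i\le k$ every part of $\alpha^i$ and every part of $\beta^i$ is $\ge\alpha^{i-1}_1$; (3) all parts of $\alpha^k$ and $\beta^k$ are $\le D$.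
   Formalization: The definition of marked Durfee symbol is corrected: all parts of every α^i and β^i, not only of α^k and β^k, must be ≤ D; otherwise the claim fails, e.g. for k=1, n=1 with D=0, α^1=(1) and all else empty. *)

(* Defs.v *)
From HB Require Import structures.
From mathcomp Require Import all_boot all_order all_algebra.
Set Implicit Arguments. Unset Strict Implicit. Unset Printing Implicit Defensive.
Import Order.TTheory GRing.Theory Num.Theory.

Definition binz (x : int) (j : nat) : rat :=
  ((\prod_(i < j) (x - i%:Z)) %:~R / (j`!)%:R)%R.

Definition is_partition (l : seq nat) : bool :=
  sorted (fun a b => b <= a) l && all (fun x => 0 < x) l.

Definition lpart (l : seq nat) : nat := head 0 l.

Fixpoint bseqs (L B : nat) : seq (seq nat) :=
  match L with
  | 0 => [:: [::]]
  | L'.+1 => [::] :: [seq x :: s | x <- iota 0 B.+1, s <- bseqs L' B]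
  end.

Fixpoint lists (T : Type) (k : nat) (s : seq T) : seq (seq T) :=
  match k with
  | 0 => [:: [::]]
  | k'.+1 => [seq x :: t | x <- s, t <- lists k' s]
  end.

(* Every partition lambda with |lambda| <= n has length <= n and parts <= n,
   hence occurs exactly once in bseqs n n. *)

Definition Nrank (m : int) (n : nat) : nat :=
  count (fun l => [&& is_partition l, sumn l == n &
                      ((lpart l)%:Z - (size l)%:Z == m)%R]) (bseqs n n).

(* A k-marked Durfee symbol is encoded as (D, ab) where
   ab = [:: (alpha^1, beta^1); ...; (alpha^k, beta^k)], i.e. the pair with
   paper index i sits at (0-based) position i-1. *)
Definition is_kDurfee (k n : nat) (eta : nat * seq (seq nat * seq nat)) : bool :=
  let D := eta.1 in
  let ab := eta.2 in
  let a i := (nth ([::], [::]) ab i).1 in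
  let b i := (nth ([::], [::]) ab i).2 in
  [&& size ab == k,
      all (fun p => is_partition p.1 && is_partition p.2) ab,
      sumn [seq sumn p.1 + sumn p.2 | p <- ab] + D * D == n,
      all (fun i => (i.+1 < k) ==> (a i != [::])) (iota 0 k),
      all (fun i => (i.+1 < k) ==> all (fun x => x <= lpart (a i)) (b i)) (iota 0 k),
      all (fun i => (0 < i) ==> all (fun x => lpart (a i.-1) <= x) (a i ++ b i))
          (iota 0 k) &
      all (fun x => x <= D) (a k.-1 ++ b k.-1) &&
      (* (3') READING: every part of every alpha^i, beta^i is
         <= D, as in any Durfee symbol.  Without this the statement is false
         (e.g. k = 1, n = 1: D = 0, alpha^1 = (1), rest empty). *)
      all (fun p => all (fun x => x <= D) (p.1 ++ p.2)) ab].

(* Finite search space containing every k-marked Durfee symbol of n exactly once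
   (D^2 <= n gives D <= n; each partition has size <= n). *)
Definition ksyms (k n : nat) : seq (nat * seq (seq nat * seq nat)) :=
  [seq (D, ab) | D <- iota 0 n.+1,
                 ab <- lists k [seq (p, q) | p <- bseqs n n, q <- bseqs n n]].

Definition Durfee_count (k n : nat) : nat := count (is_kDurfee k n) (ksyms k n).

(* eta_{2k}(n) = sum_{m in Z} binom(m+k-1, 2k) N(m;n).  Since N(m;n) = 0 unless
   -n <= m <= n, the sum is over m = i - n, 0 <= i <= 2n. *)
Definition eta2k (k n : nat) : rat :=
  (\sum_(i < (2 * n).+1)
     let m := (i%:Z - n%:Z)%R in
     binz (m + k%:Z - 1)%R (2 * k) * (Nrank m n)%:R)%R.

(* Main.v *)
Require Import Defs.
From HB Require Import structures.
From mathcomp Require Import all_boot all_order all_algebra.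
From mathcomp Require Import zify ring.
Import Order.TTheory GRing.Theory Num.Theory.
Set Implicit Arguments. Unset Strict Implicit. Unset Printing Implicit Defensive.

(* Fix the side D of the Durfee square.  In generating function terms, the
   (k+1)-marked symbols contribute h_k(x_1, ..., x_D) / (q)_D^2 with
   x_j = q^j / (1 - q^j)^2, while the unmarked ones, weighted by z^rank, give
   prod_j 1 / ((1 - z q^j)(1 - q^j / z)), whose expansion in powers of
   (z - 1)^2 / z has the same h_k as coefficients.  Both facts are read off one
   recurrence in D: removing the parts equal to D + 1 from the top pair
   (alpha, beta) translates the rank by +1 or -1, and the second central
   difference of the weight m |-> binom(m + k, 2k + 2) is binom(m + k - 1, 2k),
   which matches merging the two top pairs when the mark between them is D + 1.
   On the side of ranks, a partition is cut at its Durfee square, and the D rows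
   meeting the square are enumerated by the same recurrence, which replaces the
   usual conjugation of the part to the right of the square. *)

(** * Finite enumerations and partitions *)

Lemma bseqsS L B :
  bseqs L.+1 B = [::] :: [seq x :: s | x <- iota 0 B.+1, s <- bseqs L B].
Proof. by []. Qed.

Lemma mem_bseqs L B l : (l \in bseqs L B) = (size l <= L) && all (fun x => x <= B) l.
Proof.
elim: L l => [|L IH] [|x l] //; rewrite bseqsS inE //.
have r_mem y : (y \in iota 0 B.+1) = (y <= B) by rewrite mem_iota.
move: (iota 0 B.+1) r_mem => r r_mem; rewrite /= ltnS andbCA -IH.
apply/allpairsP/andP => [[[y s] /= [Hy Hs [-> ->]]]|[Hx Hl]]; first by rewrite -r_mem.
by exists (x, l); split; rewrite ?r_mem.
Qed.

Lemma uniq_bseqs L B : uniq (bseqs L B).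
Proof.
elim: L => // L IH; rewrite bseqsS cons_uniq; apply/andP; split.
  by apply/negP=> /allpairsP [] ? [].
apply: allpairs_uniq => //; first exact: iota_uniq.
by move=> [a b] [c d] _ _ /= [-> ->].
Qed.

Lemma mem_lists (T : eqType) k (s : seq T) l :
  (l \in lists k s) = (size l == k) && all (mem s) l.
Proof.
elim: k l => [|k IH] [|x l] //=.
  by apply/negP=> /allpairsP [] ? [].
rewrite eqSS andbCA -IH.
apply/allpairsP/andP => [[[y t] /= [Hy Ht [-> ->]]]|[Hx Hl]] //.
by exists (x, l).
Qed.

Lemma uniq_lists (T : eqType) k (s : seq T) : uniq s -> uniq (lists k s).
Proof.
move=> us; elim: k => //= k IH; apply: allpairs_uniq => //.
by move=> [a b] [c d] _ _ /= [-> ->].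
Qed.

Lemma geq_transitive : transitive (fun a b : nat => b <= a).
Proof. by move=> y a b /= ay yb; exact: leq_trans yb ay. Qed.

Lemma is_partition_cons x l :
  is_partition (x :: l) = [&& 0 < x, all (fun y => y <= x) l & is_partition l].
Proof.
rewrite /is_partition /= (path_sortedE geq_transitive).
by case: (0 < x); case: all; case: sorted; case: all.
Qed.

Lemma part_le_sumn (l : seq nat) x : x \in l -> x <= sumn l.
Proof.
elim: l => //= y l IH; rewrite inE => /predU1P [->|/IH]; first exact: leq_addr.
by move=> H; apply: leq_trans H (leq_addl _ _).
Qed.

Lemma size_partition l : is_partition l -> size l <= sumn l.
Proof. by elim: l => //= x l IH; rewrite is_partition_cons => /and3P [x0 _ /IH]; lia. Qed.

Lemma partition_in_bseqs n l : is_partition l -> sumn l <= n -> l \in bseqs n n.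
Proof.
move=> pl sl; rewrite mem_bseqs (leq_trans (size_partition pl) sl) /=.
by apply/allP=> x /part_le_sumn xl; exact: leq_trans xl sl.
Qed.

Lemma partition_le0 l : is_partition l -> all (fun x => x <= 0) l -> l = [::].
Proof. by case: l => //= x l; rewrite is_partition_cons; case: x. Qed.

(** * Marked symbols read from the top pair down *)

Notation pp := (seq nat * seq nat)%type.

Definition weight (ab : seq pp) := sumn [seq sumn p.1 + sumn p.2 | p <- ab].

Definition ppairs n : seq pp := [seq (p, q) | p <- bseqs n n, q <- bseqs n n].

Lemma uniq_ppairs n : uniq (ppairs n).
Proof.
apply: allpairs_uniq; try exact: uniq_bseqs.
by move=> [a b] [c d] _ _ /= [-> ->].
Qed.

Lemma mem_ppairs n p : (p \in ppairs n) = (p.1 \in bseqs n n) && (p.2 \in bseqs n n).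
Proof.
case: p => a b /=; apply/allpairsP/andP => [[[c d] /= [? ? [-> ->]]]|[]] //.
by exists (a, b).
Qed.

(* In the lists below the pairs run from the top one (alpha^k, beta^k) downwards,
   i.e. in the order opposite to [is_kDurfee]; the mark of [r] is the largest part
   of its first alpha, and 0 when [r] is empty. *)
Definition mark (r : seq pp) : nat := lpart (head ([::], [::]) r).1.

Definition link d (p : pp) :=
  [&& is_partition p.1, is_partition p.2, all (leq d) p.1 & all (leq d) p.2].

(** Only pairs below the top one must have a nonempty alpha that bounds their beta, so the top pair
    is kept out of the chain. *)
Fixpoint chain (r : seq pp) : bool :=
  if r is p :: r' then
    [&& link (mark r') p, p.1 != [::], all (fun x => x <= lpart p.1) p.2 & chain r']
  else true.

(* The top pair, its two caps [D1] and [D2], and the cap [E] on the mark below it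
   are kept apart so that the recurrences can lower them one at a time; the square
   itself is not counted in the size [n]. *)
Definition marked (k D1 D2 E n : nat) (x : pp * seq pp) :=
  [&& size x.2 == k, link (mark x.2) x.1, chain x.2,
      all (fun y => y <= D1) x.1.1, all (fun y => y <= D2) x.1.2,
      mark x.2 <= E & weight (x.1 :: x.2) == n].

Definition msyms k D1 D2 E n : seq (pp * seq pp) :=
  [seq x <- [seq (p, r) | p <- ppairs n, r <- lists k (ppairs n)]
   | marked k D1 D2 E n x].

Lemma uniq_msyms k D1 D2 E n : uniq (msyms k D1 D2 E n).
Proof.
apply/filter_uniq/allpairs_uniq; [exact: uniq_ppairs|exact/uniq_lists/uniq_ppairs|].
by move=> [a b] [c d] _ _ /= [-> ->].
Qed.

Lemma chain_ppairs n r : chain r -> weight r <= n -> all (mem (ppairs n)) r.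
Proof.
elim: r => //= p r IH /and4P [/and4P [p1 p2 _ _] _ _ /IH{}IH].
rewrite /weight /= -/(weight r) => wn; apply/andP; split; last by apply: IH; lia.
rewrite mem_ppairs; apply/andP; split; apply: partition_in_bseqs => //=; clear -wn; lia.
Qed.

Lemma mem_msyms k D1 D2 E n x : (x \in msyms k D1 D2 E n) = marked k D1 D2 E n x.
Proof.
rewrite mem_filter; case mx: marked => //=; case: x mx => p r.
rewrite /marked /= => /and5P [sr /and4P [p1 p2 _ _] cr _ /and3P [_ _ /eqP]].
rewrite /weight /= -/(weight r) => wn.
apply/allpairsP; exists (p, r); split=> //=.
  rewrite mem_ppairs; apply/andP; split; apply: partition_in_bseqs => //=; clear -wn; lia.
by rewrite mem_lists sr chain_ppairs //; lia.
Qed.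

(** For [k = 0] the length difference is the rank: alpha stands for the columns right of the Durfee
    square, beta for the rows below it. *)
Definition rank_sum k D1 D2 E (f : int -> rat) n : rat :=
  (\sum_(x <- msyms k D1 D2 E n) f ((size x.1.1)%:Z - (size x.1.2)%:Z))%R.

(** * Lowering the caps *)

Lemma eq_rank_sum k D1 D2 E f g n : f =1 g ->
  rank_sum k D1 D2 E f n = rank_sum k D1 D2 E g n.
Proof. by move=> fg; apply: eq_bigr => x _; rewrite fg. Qed.

(** The bound on [E] keeps the mark at most D+1, so D+1 is an admissible part of the top alpha. *)
Lemma marked_cons k D D2 E n a b r : E <= D.+1 ->
  marked k D.+1 D2 E n (D.+1 :: a, b, r)
  = (D < n) && marked k D.+1 D2 E (n - D.+1) (a, b, r).
Proof.
move=> ED; rewrite /marked /link /weight /= is_partition_cons /= leqnn /=.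
have -> : (D.+1 + sumn a + sumn b + weight r == n)
        = (D < n) && (sumn a + sumn b + weight r == n - D.+1) by lia.
case: (leqP (mark r) E) => [rE|]; last by rewrite !andbF.
have -> : mark r <= D.+1 by exact: leq_trans rE ED.
by case: (all (fun y => y <= D.+1) a); rewrite ?andbF //=; do !bool_congr.
Qed.

Lemma marked_tighten k D D2 E n a b r :
  marked k D D2 E n (a, b, r)
  = all (fun y => y <= D) a && marked k D.+1 D2 E n (a, b, r).
Proof.
rewrite /marked /=; case aD: (all _ a); rewrite ?andbF //=.
suff -> : all (fun y => y <= D.+1) a by [].
by apply: sub_all aD => y; exact: leqW.
Qed.

Lemma msyms_rec1 k D D2 E n : E <= D.+1 ->
  perm_eq (msyms k D.+1 D2 E n)
   (msyms k D D2 E n ++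
    if D < n then [seq ((D.+1 :: x.1.1, x.1.2), x.2) | x <- msyms k D.+1 D2 E (n - D.+1)]
    else [::]).
Proof.
move=> ED; apply: uniq_perm; first exact: uniq_msyms.
  rewrite cat_uniq uniq_msyms /=; case: ifP => //= _.
  rewrite map_inj_uniq ?uniq_msyms ?andbT; last first.
    by move=> [[a b] r] [[a' b'] r'] /= [-> -> ->].
  apply/hasPn => _ /mapP [[[a b] r] _ ->] /=.
  by rewrite mem_msyms marked_tighten /= ltnn.
move=> [[a b] r]; rewrite mem_cat !mem_msyms (marked_tighten k D).
set R := (_ \in _).
have -> : R = (lpart a == D.+1) && marked k D.+1 D2 E n (a, b, r).
  rewrite /R; apply/idP/andP.
    case: ifP => // Dn /mapP [[[a' b'] r'] /=]; rewrite mem_msyms => m [-> -> ->].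
    by rewrite /= eqxx marked_cons // Dn m.
  case: a {R} => [|x a] [/eqP] //= ->; rewrite marked_cons // => /andP [-> m].
  by apply/mapP; exists (a, b, r); rewrite ?mem_msyms.
case m: marked; rewrite ?andbF // !andbT.
move: m => /and5P [_ /and4P [/= pa _ _ _] _ /= aD _].
case: a {R} pa aD => //= x a; rewrite is_partition_cons => /and3P [_ ax _] /andP [xD _].
case: (ltngtP x D.+1) xD => //; last by rewrite orbT.
rewrite ltnS => xD _; rewrite xD /=; symmetry; apply/orP; left.
by apply: sub_all ax => y yx; exact: leq_trans yx xD.
Qed.

(** Multiplication of a generating function by q^(D+1), on coefficients. *)
Definition delay D (g : nat -> rat) n : rat := if D < n then g (n - D.+1) else 0%R.

Lemma rank_sum_rec1 k D D2 E f n : E <= D.+1 ->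
  rank_sum k D.+1 D2 E f n
  = (rank_sum k D D2 E f n + delay D (rank_sum k D.+1 D2 E (fun m => f (m + 1))) n)%R.
Proof.
move=> ED; rewrite {1}/rank_sum (perm_big _ (msyms_rec1 k D2 n ED)) big_cat /=.
congr (_ + _)%R; rewrite /delay; case: ifP => _; last by rewrite big_nil.
by rewrite big_map; apply: eq_bigr => x _ /=; congr f; lia.
Qed.

(** The top pair is subject to the same conditions in alpha and beta, apart from the two caps;
    exchanging them negates the rank. *)
Lemma rank_sum_swap k D1 D2 E f n :
  rank_sum k D1 D2 E f n = rank_sum k D2 D1 E (fun m => f (- m)%R) n.
Proof.
pose sw (x : pp * seq pp) := ((x.1.2, x.1.1), x.2).
have sw_mk x : marked k D2 D1 E n (sw x) = marked k D1 D2 E n x.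
  case: x => [[a b] r]; rewrite /marked /link /weight /= [sumn b + _]addnC.
  case: (is_partition a) (is_partition b) => [] [] //=.
  case: (all _ a) (all _ b) => [] [] //=.
  by congr [&& _, _ & _]; rewrite andbCA.
have pm : perm_eq (msyms k D2 D1 E n) [seq sw x | x <- msyms k D1 D2 E n].
  apply: uniq_perm; first exact: uniq_msyms.
    rewrite map_inj_uniq ?uniq_msyms //.
    by move=> [[a b] r] [[a' b'] r'] /= [-> -> ->].
  move=> x; have -> : x = sw (sw x) by case: x => [[]].
  rewrite mem_map; last by move=> [[a b] r] [[a' b'] r'] /= [-> -> ->].
  by rewrite !mem_msyms sw_mk.
rewrite [RHS]/rank_sum (perm_big _ pm) big_map; apply: eq_bigr => x _ /=.
by rewrite opprB.
Qed.

Lemma rank_sum_rec2 k D D1 E f n : E <= D.+1 ->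
  rank_sum k D1 D.+1 E f n
  = (rank_sum k D1 D E f n + delay D (rank_sum k D1 D.+1 E (fun m => f (m - 1))) n)%R.
Proof.
move=> ED; rewrite rank_sum_swap rank_sum_rec1 // -rank_sum_swap.
congr (_ + _)%R; rewrite /delay; case: ifP => // _; rewrite [RHS]rank_sum_swap.
by apply: eq_rank_sum => m; congr f; lia.
Qed.

Lemma delayD D g h n :
  delay D (fun i => g i + h i)%R n = (delay D g n + delay D h n)%R.
Proof. by rewrite /delay; case: ifP => // _; rewrite addr0. Qed.

Lemma delayB D g h n :
  delay D (fun i => g i - h i)%R n = (delay D g n - delay D h n)%R.
Proof. by rewrite /delay; case: ifP => // _; rewrite subr0. Qed.

Lemma eq_delay D g h n : (forall i, i < n -> g i = h i) -> delay D g n = delay D h n.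
Proof. by rewrite /delay; case: ifP => // Dn; apply; lia. Qed.

(** Coefficient form of multiplying by (1 - z q^(D+1)) (1 - q^(D+1) / z); in the cross term the two
    translations of the rank cancel. *)
Lemma rank_sum_rec k D f n :
  rank_sum k D.+1 D.+1 D.+1 f n
  = (rank_sum k D D D.+1 f n
     + delay D (rank_sum k D.+1 D.+1 D.+1 (fun m => f (m + 1))) n
     + delay D (rank_sum k D.+1 D.+1 D.+1 (fun m => f (m - 1))) n
     - delay D (delay D (rank_sum k D.+1 D.+1 D.+1 f)) n)%R.
Proof.
rewrite rank_sum_rec1 // rank_sum_rec2 // -!addrA; congr (_ + _)%R.
rewrite [LHS]addrC; congr (_ + _)%R; rewrite -delayB.
(* The beta step left alpha capped by D; the alpha recurrence, read backwards, restores the cap D+1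
   and yields the double delay. *)
apply: eq_delay => i _; rewrite [rank_sum k D.+1 D.+1 _ _ _]rank_sum_rec1 //.
rewrite -addrA -[LHS]addr0; congr (_ + _)%R; symmetry.
apply/eqP; rewrite subr_eq0; apply/eqP/eq_delay => j _.
by apply: eq_rank_sum => m; rewrite addrK.
Qed.

(** Once the part D+1 that realises the mark is removed, the conditions of [chain] on its pair
    become those of a top pair with both caps D+1. *)
Lemma marked_collapse k D n a b r :
  marked k.+1 D D D.+1 n ([::], [::], (D.+1 :: a, b) :: r)
  = (D < n) && marked k D.+1 D.+1 D.+1 (n - D.+1) (a, b, r).
Proof.
rewrite /marked /weight /= /link /= is_partition_cons /= leqnn /= eqSS.
have -> : (D.+1 + sumn a + sumn b + weight r == n)
        = (D < n) && (sumn a + sumn b + weight r == n - D.+1) by lia.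
case: (mark r <= D.+1); last by rewrite !(andbF, andFb).
case: (all (fun y => y <= D.+1) a); last by rewrite !(andbF, andFb).
case: (all (fun y => y <= D.+1) b); last by rewrite !(andbF, andFb).
by rewrite !(andTb, andbT); case: (D < n); rewrite !(andbF, andbT, andTb, andFb) // -!andbA.
Qed.

Lemma msyms_collapse k D n :
  perm_eq (msyms k.+1 D D D.+1 n)
   (msyms k.+1 D D D n ++
    if D < n then
      [seq (([::], [::]), (D.+1 :: x.1.1, x.1.2) :: x.2)
      | x <- msyms k D.+1 D.+1 D.+1 (n - D.+1)]
    else [::]).
Proof.
have inj : injective (fun x : pp * seq pp =>
    (([::], [::]) : pp, (D.+1 :: x.1.1, x.1.2) :: x.2)).
  by move=> [[a b] r] [[a' b'] r'] /= [-> -> ->].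
apply: uniq_perm; first exact: uniq_msyms.
  rewrite cat_uniq uniq_msyms /=; case: ifP => //= _.
  rewrite map_inj_uniq ?uniq_msyms ?andbT //.
  apply/hasPn => _ /mapP [[[a b] r] _ ->] /=.
  by rewrite mem_msyms /marked /= /mark /= ltnn !andbF.
move=> [[a b] r]; rewrite mem_cat !mem_msyms.
have -> : marked k.+1 D D D n (a, b, r)
    = (mark r <= D) && marked k.+1 D D D.+1 n (a, b, r).
  rewrite /marked /=; case: (leqP (mark r) D) => rD; last by rewrite !andbF.
  by rewrite (leqW rD).
set R := (_ \in _).
have -> : R = (mark r == D.+1) && marked k.+1 D D D.+1 n (a, b, r).
  rewrite /R; apply/idP/andP.
    case: ifP => // Dn /mapP [[[a' b'] r'] /=]; rewrite mem_msyms => m [-> -> ->].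
    by rewrite marked_collapse Dn m /mark /= eqxx.
  move=> {R} [/eqP rD m]; move: (m) => /and5P [_ /and4P [/= _ _ ra rb] _ /= aD /and3P [bD _ _]].
  (* With mark D+1 and caps D, no part fits in the top pair. *)
  have nil s : all (leq (mark r)) s -> all (fun y => y <= D) s -> s = [::].
    by rewrite rD; case: s => //= x s /andP [? _] /andP [? _]; lia.
  move: m; rewrite {ra aD}(nil _ ra aD) {rb bD}(nil _ rb bD).
  case: r rD {nil} => [|[[|x a'] b'] r'] //; rewrite /mark /= => ->.
  rewrite marked_collapse => /andP [-> m].
  by apply/mapP; exists (a', b', r'); rewrite ?mem_msyms.
case m: marked; rewrite ?andbF // !andbT.
by move: m => /and5P [_ _ _ _ /and3P [_ /= rD _]]; rewrite leq_eqVlt ltnS orbC in rD.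
Qed.

Lemma rank_sum_collapse k D n :
  rank_sum k.+1 D D D.+1 (fun=> 1%R) n
  = (rank_sum k.+1 D D D (fun=> 1) n
     + delay D (rank_sum k D.+1 D.+1 D.+1 (fun=> 1)) n)%R.
Proof.
rewrite {1}/rank_sum (perm_big _ (msyms_collapse k D n)) big_cat /=.
congr (_ + _)%R; rewrite /delay; case: ifP => _; last by rewrite big_nil.
by rewrite big_map.
Qed.

(** With no pair below the top, the mark is 0 and meets every cap; this lets the recurrence pass
    from [E] = D+1 to D. *)
Lemma rank_sum0_cap D1 D2 E E' f n : rank_sum 0 D1 D2 E f n = rank_sum 0 D1 D2 E' f n.
Proof.
apply: perm_big; apply: uniq_perm; try exact: uniq_msyms.
by move=> [p [|? ?]]; rewrite !mem_msyms.
Qed.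

Lemma marked000 k n a b r : marked k 0 0 0 n (a, b, r) -> [/\ k = 0, a = [::] & b = [::]].
Proof.
move=> /and5P [/eqP <- /and4P [/= pa pb _ _] cr /= a0 /and3P [b0 r0 _]].
split; [|exact: partition_le0..].
case: r cr r0 => //= -[a' b'] r /and4P [/and4P [/= pa' _ _ _] a'0 _ _].
by rewrite /mark /=; case: a' pa' a'0 => //= x a'; rewrite is_partition_cons; case: x.
Qed.

(** * The binomial weight *)

Definition bink k (m : int) : rat := binz (m + k%:Z - 1)%R (2 * k).

(** Pascal's rule: all three products share x(x-1)...(x-j+1), and x + 1 = (x - j) + (j + 1). *)
Lemma binzS (x : int) j : binz (x + 1)%R j.+1 = (binz x j.+1 + binz x j)%R.
Proof.
rewrite /binz factS natrM big_ord_recl [nat_of_ord _]/= subr0.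
rewrite (eq_bigr (fun i : 'I_j => x - i%:Z)%R); last by move=> i _; rewrite lift0; lia.
rewrite big_ord_recr [nat_of_ord _]/=; set P := (\prod_(i < j) _)%R.
rewrite !rmorphM rmorphB rmorphD.
by field; rewrite nat1r !pnatr_eq0 -lt0n fact_gt0.
Qed.

(** Two uses of Pascal's rule lower the bottom index by 2; the shift by [k] in the top argument
    centres the difference. *)
Lemma bink_second_diff k (m : int) :
  (bink k.+1 (m + 1) + bink k.+1 (m - 1) = 2 * bink k.+1 m + bink k m)%R.
Proof.
rewrite /bink; have -> : 2 * k.+1 = (2 * k).+2 by lia.
set x := (m + k%:Z - 1)%R.
have -> : (m + 1 + k.+1%:Z - 1 = x + 1 + 1)%R by rewrite /x; lia.
have -> : (m - 1 + k.+1%:Z - 1 = x)%R by rewrite /x; lia.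
have -> : (m + k.+1%:Z - 1 = x + 1)%R by rewrite /x; lia.
rewrite !binzS; ring.
Qed.

Lemma bink0 m : bink 0 m = 1%R.
Proof. by rewrite /bink /binz big_ord0. Qed.

(** The top argument is k, a root of the product since k < 2k+2. This settles D = 0, where the only
    rank is 0. *)
Lemma binkS_at0 k : bink k.+1 0 = 0%R.
Proof.
have lt_k : k < 2 * k.+1 by lia.
rewrite /bink /binz (bigD1 (Ordinal lt_k)) //=.
have -> : (0 + k.+1%:Z - 1 - k%:Z = 0)%R by lia.
by rewrite !mul0r.
Qed.

(** * The common recurrence in D *)

Lemma rank_sumD k D1 D2 E f g n :
  (rank_sum k D1 D2 E (fun m => f m + g m) n
   = rank_sum k D1 D2 E f n + rank_sum k D1 D2 E g n)%R.
Proof. exact: big_split. Qed.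

(** Here the term in [A k] comes from the second difference of the weight. *)
Lemma rank_sum_bink_rec k D n :
  let A j := rank_sum 0 D.+1 D.+1 D.+1 (bink j) in
  A k.+1 n = (rank_sum 0 D D D (bink k.+1) n + 2 * delay D (A k.+1) n
              + delay D (A k) n - delay D (delay D (A k.+1)) n)%R.
Proof.
move=> A; rewrite {1}/A rank_sum_rec (rank_sum0_cap _ _ _ D) -/(A _).
congr (_ - _)%R; rewrite -!addrA; congr (_ + _)%R.
rewrite mulr_natl mulr2n -!delayD; apply: eq_delay => i _; rewrite -!rank_sumD.
by apply: eq_rank_sum => m; rewrite bink_second_diff mulr_natl mulr2n.
Qed.

(** A constant weight does not see the translations of the rank; the term in [A k] now comes from
    the symbols whose mark is D+1. *)
Lemma rank_sum_marked_rec k D n :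
  let A j := rank_sum j D.+1 D.+1 D.+1 (fun=> 1%R) in
  A k.+1 n = (rank_sum k.+1 D D D (fun=> 1) n + 2 * delay D (A k.+1) n
              + delay D (A k) n - delay D (delay D (A k.+1)) n)%R.
Proof.
move=> A; rewrite {1}/A rank_sum_rec rank_sum_collapse -/(A _) -/(A _).
ring.
Qed.

(** Three nested inductions: on [k] for the term in [A k], on [D] for the undelayed term, and on [n]
    because a delay strictly lowers the size. *)
Theorem rank_sum_marked k D n :
  rank_sum k D D D (fun=> 1%R) n = rank_sum 0 D D D (bink k) n.
Proof.
elim: k D n => [|k IHk] D n; first by apply: eq_rank_sum => m; rewrite bink0.
elim: D n => [|D IHD] n.
  rewrite /rank_sum ![LHS]big_seq ![RHS]big_seq !big1 // => -[[a b] r];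
    rewrite mem_msyms => /marked000 [] // _ -> -> /=; exact: binkS_at0.
elim/ltn_ind: n => n IHn.
rewrite rank_sum_marked_rec rank_sum_bink_rec IHD.
rewrite [delay D (rank_sum k _ _ _ _) n](eq_delay _ (fun i _ => IHk D.+1 i)).
rewrite (eq_delay _ IHn); congr (_ - _)%R; apply: eq_delay => i lt_in.
by apply: eq_delay => j lt_ji; apply: IHn; exact: ltn_trans lt_in.
Qed.

(** * Partitions cut along a rectangle *)

(* [t.1] lists the [D] rows, each of length at least [c], that meet a rectangle of
   height [D] and width [c]; [t.2] lists the rows below; [s] counts the cells
   outside the rectangle. *)
Definition lifted (D c B s : nat) (t : pp) :=
  [&& sorted (fun a b => b <= a) t.1, size t.1 == D, all (leq c) t.1,
      is_partition t.2, all (fun y => y <= B) t.2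
    & sumn t.1 + sumn t.2 == s + c * D].

(** For [c = 0] the rows of [t.1] may be 0, so their sum does not bound their number; the last
    summand [D] of the bound does. *)
Definition lsyms D c B s : seq pp := [seq t <- ppairs (s + c * D + D) | lifted D c B s t].

Lemma uniq_lsyms D c B s : uniq (lsyms D c B s).
Proof. exact/filter_uniq/uniq_ppairs. Qed.

Lemma mem_lsyms D c B s t : (t \in lsyms D c B s) = lifted D c B s t.
Proof.
rewrite mem_filter; case l_t: lifted => //=.
move: l_t => /and5P [_ /eqP sz _ p2 /andP [_ /eqP sm]].
rewrite mem_ppairs mem_bseqs sz leq_addl /=; apply/andP; split.
  by apply/allP => x /part_le_sumn; clear -sm; lia.
by apply: partition_in_bseqs => //; clear -sm; lia.
Qed.

(* For [D = 0] the default [c] of [head] makes the weight independent of [c]. *)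
Definition lifted_sum D c B (f : int -> rat) s : rat :=
  (\sum_(t <- lsyms D c B s) f ((head c t.1)%:Z - c%:Z - (size t.2)%:Z))%R.

Lemma lifted_sum0 c B f s : lifted_sum 0 c B f s = rank_sum 0 0 B 0 f s.
Proof.
have pm : perm_eq (lsyms 0 c B s) [seq x.1 | x <- msyms 0 0 B 0 s].
  have nil : {in msyms 0 0 B 0 s, forall x, x = (([::], x.1.2), [::])}.
    move=> [[a b] r]; rewrite mem_msyms => /and5P [/nilP /= -> /and4P [/= pa _ _ _] _ /= a0 _].
    by rewrite (partition_le0 pa a0).
  apply: uniq_perm; first exact: uniq_lsyms.
    rewrite map_inj_in_uniq ?uniq_msyms // => x y /nil -> /nil -> /= [->] //.
  move=> [a b]; rewrite mem_lsyms; apply/idP/mapP.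
    case/and5P=> /= _ /nilP -> _ pb /andP [bB sb].
    exists (([::], b), [::]) => //; rewrite mem_msyms /marked /link /= pb bB.
    by rewrite /weight /= !addn0 add0n; rewrite muln0 addn0 in sb; rewrite sb /= andbT; apply/allP.
  case=> x xm ->; move: (xm); rewrite (nil x xm) mem_msyms.
  case/and5P=> _ /and4P [/= _ pb _ _] _ _ /andP [bB]; rewrite /weight /= => /eqP <-.
  by rewrite /lifted /= pb bB; apply/eqP; clear; lia.
rewrite /lifted_sum (perm_big _ pm) big_map /rank_sum !big_seq.
apply: eq_bigr => -[[a b] r]; rewrite mem_msyms.
case/and5P=> _ /and4P [/= pa _ _ _] _ /= a0 _; rewrite (partition_le0 pa a0) /=.
by rewrite subrr.
Qed.

Lemma sumn_lower c (t : seq nat) : all (leq c) t -> c * size t <= sumn t.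
Proof. by elim: t => //= [|x t IH]; [rewrite muln0 | case/andP => cx /IH; clear -cx; nia]. Qed.

Lemma sorted_geq_rcons (t : seq nat) c :
  sorted (fun a b => b <= a) (rcons t c) = sorted (fun a b => b <= a) t && all (leq c) t.
Proof.
by rewrite !(sorted_pairwise geq_transitive) pairwise_rcons andbC.
Qed.

Lemma lifted_rcons D c B s a b :
  lifted D.+1 c B s (rcons a c, b) = lifted D c B s (a, b).
Proof.
rewrite /lifted /= sorted_geq_rcons size_rcons eqSS all_rcons leqnn sumn_rcons /=.
have -> : (sumn a + c + sumn b == s + c * D.+1) = (sumn a + sumn b == s + c * D).
  by rewrite mulnS; lia.
by case: (all (leq c) a); rewrite ?andbF ?andbT.
Qed.

(** When all rows exceed [c], the rectangle gains a column and absorbs D+1 outer cells. *)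
Lemma lifted_raise D c B s t :
  lifted D.+1 c B s t && all (leq c.+1) t.1 = (D < s) && lifted D.+1 c.+1 B (s - D.+1) t.
Proof.
case: t => a b; rewrite /lifted /=; case sz: (size a == D.+1); last by rewrite !andbF.
case ca: (all (leq c.+1) a); last by rewrite !andbF.
have -> : all (leq c) a by apply: sub_all ca => x; exact: ltnW.
case: sorted; rewrite ?andbF //=; case: is_partition; rewrite ?andbF //=.
case: all; rewrite ?andbF //= andbT.
(* The D+1 rows of length at least c+1 force D < s, so the subtraction is exact. *)
have := sumn_lower ca; rewrite (eqP sz); clear; nia.
Qed.

(** Either the shortest row has length exactly [c] and is dropped, or the rectangle widens. A new
    column is a part D+1 of the conjugate, whence the shape of [msyms_rec1]. *)
Lemma lsyms_rec D c B s :
  perm_eq (lsyms D.+1 c B s)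
    ([seq (rcons t.1 c, t.2) | t <- lsyms D c B s] ++
     if D < s then lsyms D.+1 c.+1 B (s - D.+1) else [::]).
Proof.
have inj : injective (fun t : pp => (rcons t.1 c, t.2) : pp).
  by move=> [a b] [a' b'] /= [] /rcons_inj [-> ] ->.
apply: uniq_perm; first exact: uniq_lsyms.
  rewrite cat_uniq map_inj_uniq ?uniq_lsyms //=; apply/andP; split.
    apply/hasPn => t; case: ifP => // _; rewrite mem_lsyms => /and5P [_ _ ct _ _].
    apply/negP => /mapP [t' _ tE]; move: ct; rewrite tE /= all_rcons.
    by rewrite ltnn.
  by case: ifP; rewrite ?uniq_lsyms.
move=> [a b]; rewrite mem_cat mem_lsyms.
have -> : ((a, b) \in if D < s then lsyms D.+1 c.+1 B (s - D.+1) else [::])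
          = lifted D.+1 c B s (a, b) && all (leq c.+1) a.
  by rewrite lifted_raise; case: ifP; rewrite ?mem_lsyms.
apply/idP/orP => [l_ab|[/mapP [[a' b'] + [-> ->]]|/andP []//]]; last first.
  by rewrite mem_lsyms lifted_rcons.
rewrite l_ab /=; case ca: (all _ a); [by right|left].
move: (l_ab) => /and5P [/= so sz cle _ _].
case/lastP: a so sz cle ca l_ab => [|a x]; first by [].
rewrite sorted_geq_rcons !all_rcons => /andP [_ xa] _ /andP [cx _].
case: (ltngtP c x) cx => // [cx _|<- _ _].
  by have -> : all (leq c.+1) a by apply: sub_all xa => y; exact: leq_trans.
by rewrite lifted_rcons => l_ab; apply/mapP; exists (a, b); rewrite ?mem_lsyms.
Qed.

(** Both sides obey the recurrence of [rank_sum_rec1]. The inner induction quantifies over [c] and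
    [f]: widening raises [c] and translates the argument of [f] by 1. *)
Lemma lifted_sum_rank_sum D c B f s : lifted_sum D c B f s = rank_sum 0 D B 0 f s.
Proof.
elim: D c f s => [|D IHD] c f s; first exact: lifted_sum0.
elim/ltn_ind: s c f => s IHs c f.
rewrite rank_sum_rec1 // -(IHD c) /lifted_sum (perm_big _ (lsyms_rec D c B s)) big_cat /=.
congr (_ + _)%R.
  rewrite big_map; apply: eq_bigr => -[a b] _ /=; congr (f (_ - _ - _)%R).
  (* If [a] is empty, the dropped row is the first one and equals the default [c] of [head]. *)
  by case: a.
rewrite /delay; case: ifP => Ds; last by rewrite big_nil.
rewrite -(IHs _ _ c.+1); last by lia.
rewrite /lifted_sum !big_seq; apply: eq_bigr => -[a b]; rewrite mem_lsyms => /and5P [_ /= sz _ _ _].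
by case: a sz => //= x a _; congr f; lia.
Qed.

(** * Durfee squares and sums over ranks *)

Definition durfee D (l : seq nat) :=
  [&& D <= size l, all (leq D) (take D l) & all (fun y => y <= D) (drop D l)].

Definition rank (l : seq nat) : int := ((lpart l)%:Z - (size l)%:Z)%R.

(** If D < D', the row of index D lies below the smaller square and meets the larger one, so D' is
    at most that row and that row at most D. *)
Lemma durfee_uniq D D' l : durfee D l -> durfee D' l -> D = D'.
Proof.
wlog lt_DD : D D' / D < D'.
  move=> W dD dD'; case: (ltngtP D D') => // lt; first exact: W.
  by symmetry; exact: W.
move=> /and3P [_ _ dr] /and3P [sz tk _]; exfalso.
have lt_s : D < size l by exact: leq_trans lt_DD sz.
have /(_ (nth 0 l D)) H1 := allP dr; have /(_ (nth 0 l D)) H2 := allP tk.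
have h1 : nth 0 l D <= D.
  by apply: H1; rewrite (drop_nth 0) // mem_head.
have h2 : D' <= nth 0 l D.
  by apply: H2; rewrite -(nth_take 0 lt_DD) mem_nth // size_takel.
by clear -h1 h2 lt_DD; lia.
Qed.

(** The side is the least 0-based index whose row does not exceed it; the default 0 of [nth] makes
    [size l] such an index. *)
Lemma durfee_exists l : is_partition l -> exists D, durfee D l.
Proof.
move=> /andP [so _].
have ex : exists i, nth 0 l i <= i by exists (size l); rewrite nth_default.
have mono i j : i <= j -> j < size l -> nth 0 l j <= nth 0 l i.
  move=> ij js; have := sorted_leq_nth geq_transitive (fun x => leqnn x) 0 so.
  by apply => //; rewrite inE //; exact: leq_ltn_trans js.
case: (ex_minnP ex) => D DD Dmin; exists D.
have D_sz : D <= size l by apply: Dmin; rewrite nth_default.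
apply/and3P; split=> //; apply/(all_nthP 0) => i; rewrite ?size_takel ?size_drop // => iD.
  rewrite nth_take //; have : D.-1 < nth 0 l D.-1.
    by rewrite ltnNge; apply/negP => /Dmin; clear -iD; lia.
  have : nth 0 l D.-1 <= nth 0 l i by apply: mono; clear -iD D_sz; lia.
  by clear -iD; lia.
by rewrite nth_drop; apply: leq_trans (mono D _ _ _) DD; clear -iD; lia.
Qed.

Lemma perm_durfee D n :
  perm_eq [seq l <- bseqs n n | [&& is_partition l, sumn l == n & durfee D l]]
    (if D * D <= n then [seq t.1 ++ t.2 | t <- lsyms D D D (n - D * D)] else [::]).
Proof.
apply: uniq_perm; first exact/filter_uniq/uniq_bseqs.
  case: ifP => // _; rewrite map_inj_in_uniq ?uniq_lsyms // => -[a b] [a' b'].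
  rewrite !mem_lsyms => /and5P [_ /= /eqP sz _ _ _] /and5P [_ /= /eqP sz' _ _ _] /eqP.
  by rewrite eqseq_cat ?sz ?sz' // => /andP [/eqP -> /eqP ->].
move=> l; rewrite mem_filter; apply/idP/idP.
  move=> /andP [/and3P [pl /eqP sl /and3P [szD tk dr]] _].
  have sE : sumn (take D l) + sumn (drop D l) = n by rewrite -sumn_cat cat_take_drop.
  have Dn : D * D <= n.
    by rewrite -sE; apply: leq_trans (leq_addr _ _); have := sumn_lower tk; rewrite size_takel.
  rewrite Dn; apply/mapP; exists (take D l, drop D l); last by rewrite cat_take_drop.
  move: pl; rewrite mem_lsyms /lifted /= size_takel // eqxx tk dr sE subnK // eqxx /= andbT.
  rewrite /is_partition -{1 2}[l](cat_take_drop D) all_cat !(sorted_pairwise geq_transitive) pairwise_cat.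
  by move=> /andP [/and3P [_ -> ->] /andP [_ ->]].
case: ifP => // Dn /mapP [[a b] + ->]; rewrite mem_lsyms.
move=> /and5P [/= so /eqP sz Da /andP [sb pb] /andP [bD /eqP sm]].
have sn : sumn (a ++ b) = n by rewrite sumn_cat sm subnK.
have pab : is_partition (a ++ b).
  rewrite /is_partition all_cat pb andbT; apply/andP; split.
    rewrite (sorted_pairwise geq_transitive) pairwise_cat -!(sorted_pairwise geq_transitive) so sb !andbT.
    by apply/allrelP => x y /(allP Da) /= Dx /(allP bD) /= yD; exact: leq_trans Dx.
  (* Rows of length at least D are positive unless D = 0, and then [a] is empty. *)
  case: D sz Da {Dn bD sm} => [/eqP|D _]; first by rewrite size_eq0 => /eqP ->.
  by apply: sub_all => x; exact: leq_trans.
rewrite pab sn eqxx /= partition_in_bseqs ?sn // andbT.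
by rewrite /durfee size_cat sz leq_addr take_size_cat // drop_size_cat // Da.
Qed.

(** The side D counts once in the first row and once in the number of rows, so it cancels in the
    rank. *)
Lemma sum_rank_durfee f D n :
  (\sum_(l <- bseqs n n | [&& is_partition l, sumn l == n & durfee D l]) f (rank l)
   = if (D * D <= n)%N then rank_sum 0 D D D f (n - D * D)%N else 0)%R.
Proof.
rewrite -big_filter (perm_big _ (perm_durfee D n)); case: ifP => Dn; last by rewrite big_nil.
rewrite (rank_sum0_cap _ _ _ 0) -(lifted_sum_rank_sum D D) big_map /lifted_sum !big_seq.
apply: eq_bigr => -[a b]; rewrite mem_lsyms => /and5P [/= _ /eqP sz _ pb /andP [bD _]].
rewrite /rank size_cat sz; case: a sz => [|x a] sz /=; last by congr f; clear; lia.
move: pb bD; rewrite -sz /= => pb bD; rewrite (partition_le0 pb bD) /=.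
by congr f; lia.
Qed.

Lemma sum_rank f n :
  (\sum_(l <- bseqs n n | is_partition l && (sumn l == n)) f (rank l)
   = \sum_(D < n.+1) if (D * D <= n)%N then rank_sum 0 D D D f (n - D * D)%N else 0)%R.
Proof.
under [RHS]eq_bigr => D _ do rewrite -sum_rank_durfee big_mkcond.
rewrite exchange_big big_mkcond /=; apply: eq_bigr => l _.
case: ifP => [/andP [pl /eqP sl]|npl]; last first.
  by rewrite big1 // => D _; rewrite andbA npl.
have [D dD] := durfee_exists pl.
have Dn : D < n.+1.
  move: dD => /and3P [Dsz _ _]; apply: leq_trans Dsz _.
  by rewrite -sl size_partition.
rewrite (bigD1 (Ordinal Dn)) //= pl sl eqxx dD /= big1 ?addr0 // => D' neq.
case: ifP => // dD'; case/eqP: neq; apply/val_inj; exact: durfee_uniq dD' dD.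
Qed.

Lemma eta2kE k n :
  eta2k k n = (\sum_(l <- bseqs n n | is_partition l && (sumn l == n)) bink k (rank l))%R.
Proof.
have part_in l : is_partition l -> sumn l = n ->
    absz (rank l + n%:Z)%R < (2 * n).+1 /\ (0 <= rank l + n%:Z)%R.
  move=> pl sl; have := size_partition pl; have : lpart l <= sumn l.
    by case: (l) => //= x s; exact: leq_addr.
  by rewrite sl /rank; clear; lia.
transitivity (\sum_(i < (2 * n).+1) \sum_(l <- bseqs n n |
    [&& is_partition l, sumn l == n & rank l == i%:Z - n%:Z]) bink k (rank l))%R.
  apply: eq_bigr => i _ /=; rewrite -/(bink k _) /Nrank -sum1_count natr_sum mulr_sumr.
  by apply: eq_bigr => l /and3P [_ _ /eqP lE]; rewrite mulr1 /rank lE.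
under eq_bigr => i _ do rewrite big_mkcond.
rewrite exchange_big [RHS]big_mkcond /=; apply: eq_bigr => l _.
case: ifP => [/andP [pl /eqP sl]|npl]; last first.
  by rewrite big1 // => D _; rewrite andbA npl.
have [ln l0] := part_in l pl sl.
(* The only index contributing for [l] is its rank plus n. *)
rewrite (bigD1 (Ordinal ln)) //= pl sl eqxx big1 ?addr0 => [|i neq] /=.
  by have -> : rank l == ((absz (rank l + n%:Z))%:Z - n%:Z)%R by lia.
case: ifP => // /eqP E; case/eqP: neq; apply: val_inj => /=; lia.
Qed.

(** * From indexed symbols to chains *)

Notation p0 := (([::], [::]) : pp).

Lemma chainP r :
  reflect (forall j, j < size r ->
             [&& link (lpart (nth p0 r j.+1).1) (nth p0 r j), (nth p0 r j).1 != [::]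
               & all (fun x => x <= lpart (nth p0 r j).1) (nth p0 r j).2])
          (chain r).
Proof.
elim: r => [|p r IH] /=; first by constructor.
apply: (iffP and4P) => [[lp p1 p2 /IH cr] [_|j /cr] //|H].
  by rewrite /= nth0 lp p1 p2.
by have := H 0 isT; rewrite /= nth0 => /and3P [-> -> ->]; split=> //; apply/IH => j /(H j.+1).
Qed.

Lemma partition_le_lpart a : is_partition a -> all (fun x => x <= lpart a) a.
Proof. by case: a => //= x a; rewrite is_partition_cons leqnn => /and3P []. Qed.

Lemma lpart_le D a : all (fun x => x <= D) a -> lpart a <= D.
Proof. by case: a => //= x a /andP []. Qed.

(** Marks do not increase downwards and each bounds its own pair, so the cap on the first mark
    reaches every part. *)
Lemma chain_le D r : chain r -> mark r <= D ->
  all (fun p => all (fun x => x <= D) (p.1 ++ p.2)) r.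
Proof.
elim: r => //= p r IH /and4P [/and4P [pa pb ma _] a0 ba /IH{}IH].
rewrite /mark /= => aD; apply/andP; split.
  rewrite all_cat; apply/andP; split; [move: (partition_le_lpart pa)|move: ba];
    by apply: sub_all => x xa; exact: leq_trans xa aD.
apply: IH; apply: leq_trans aD; move: ma a0.
by case: (p.1) => //= x a /andP [].
Qed.

Lemma chain_partition r : chain r -> all (fun p => is_partition p.1 && is_partition p.2) r.
Proof. by elim: r => //= p r IH /and4P [/and4P [-> -> _ _] _ _ /IH]. Qed.

(** Reversal sends position i to k - i. The bound D on all parts reduces to the caps on the top pair
    and on the mark, by [chain_le]. *)
Lemma is_kDurfee_rev k n D p r :
  is_kDurfee k.+1 n (D, rev (p :: r))
  = (D * D <= n) && marked k D D D (n - D * D) (p, r).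
Proof.
have io i : (i \in iota 0 k.+1) = (i <= k) by rewrite mem_iota.
rewrite /is_kDurfee /marked; move: (iota 0 k.+1) io => I io; rewrite /= size_rev /= eqSS.
case sz: (size r == k); last by rewrite !andbF.
move/eqP: sz => sz.
have nthE i : i <= k -> nth p0 (rev (p :: r)) i = nth p0 (p :: r) (k - i).
  by move=> ik; rewrite nth_rev /= sz ?ltnS // subSS.
rewrite !all_rev (nthE k) // subnn map_rev sumn_rev -/(weight (p :: r)) /=.
have -> : (weight (p :: r) + D * D == n) = (D * D <= n) && (weight (p :: r) == n - D * D).
  by lia.
case Dn: (D * D <= n); last by rewrite !(andbF, andFb).
case wn: (weight _ == _); last by rewrite !(andbF, andFb).
rewrite !(andbT, andTb); apply/idP/idP.
  move=> /and5P [/andP [/andP [pa pb] pr] /allP ne /allP bl /allP lw].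
  move=> /and3P [top _ allD].
  have {}ne j : j < k -> (nth p0 r j).1 != [::].
    move=> jk; have := ne (k - j.+1); rewrite io leq_subr nthE ?leq_subr //.
    by rewrite subKn //= => /(_ isT) /implyP; apply; lia.
  have {}bl j : j < k -> all (fun x => x <= lpart (nth p0 r j).1) (nth p0 r j).2.
    move=> jk; have := bl (k - j.+1); rewrite io leq_subr nthE ?leq_subr //.
    by rewrite subKn //= => /(_ isT) /implyP; apply; lia.
  have {}lw j : all (leq (lpart (nth p0 r j).1)) (nth p0 (p :: r) j).1
             && all (leq (lpart (nth p0 r j).1)) (nth p0 (p :: r) j).2.
    case: (ltnP j k) => jk; last first.
      by rewrite nth_default ?sz //=; apply/andP; split; apply/allP.
    have := lw (k - j); rewrite io leq_subr !nthE ?leq_subr //; last by lia.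
    rewrite subKn ?(ltnW jk) // => /(_ isT) /implyP; rewrite subn_gt0 jk => /(_ isT).
    have -> : k - (k - j).-1 = j.+1 by lia.
    by rewrite all_cat.
  have pn j : is_partition (nth p0 r j).1 && is_partition (nth p0 r j).2.
    case: (ltnP j (size r)) => jr; last by rewrite nth_default.
    by apply: (allP pr); rewrite mem_nth.
  move: top; rewrite all_cat => /andP [-> ->]; rewrite /=.
  have := lw 0; rewrite nth0 -/(mark r) /link pa pb /= => -> /=.
  apply/andP; split.
    apply/chainP => j; rewrite sz => jk; rewrite ne // bl // !andbT.
    by have := lw j.+1; have := pn j; rewrite /link /= => /andP [-> ->].
  rewrite /mark; case: (r) allD => //= q r' /andP [].
  by rewrite all_cat => /andP [/lpart_le].
move=> /and5P [lp cr aD bD rD].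
move: (lp) => /and4P [pa pb lpa lpb].
have cj j : j < k -> _ := fun jk => chainP _ cr j (eq_rect_r (fun m => j < m) jk sz).
rewrite pa pb chain_partition // chain_le //= !all_cat aD bD !andbT /=.
apply/and3P; split; apply/allP => i; rewrite io => ik; apply/implyP.
- move=> ik'; rewrite nthE //; have -> : k - i = (k - i.+1).+1 by lia.
  by case/and3P: (cj (k - i.+1) ltac:(lia)).
- move=> ik'; rewrite nthE //; have -> : k - i = (k - i.+1).+1 by lia.
  by case/and3P: (cj (k - i.+1) ltac:(lia)).
move=> i0; rewrite !nthE //; last by lia.
have -> : k - i.-1 = (k - i).+1 by lia.
(* For i = k the pair is the top one, bounded by its own [link]; otherwise the link is inside the
   chain. *)
rewrite all_cat /=; case: (posnP (k - i)) => [->|ki].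
  by rewrite nth0 /= -/(mark r) lpa lpb.
rewrite -(prednK ki) /=.
by case/and3P: (cj (k - i).-1 ltac:(lia)) => /and4P [_ _ -> ->].
Qed.

Lemma count_kDurfee k n D :
  count (fun ab => is_kDurfee k.+1 n (D, ab)) (lists k.+1 (ppairs n))
  = if D * D <= n then size (msyms k D D D (n - D * D)) else 0.
Proof.
have mE p r := is_kDurfee_rev k n D p r.
have rev_cons ab : is_kDurfee k.+1 n (D, ab) -> exists p r, ab = rev (p :: r).
  move=> /and3P [/= /eqP sz _ _]; case E: (rev ab) => [|p r].
    by move: sz; rewrite -(size_rev ab) E.
  by exists p, r; rewrite -E revK.
case: ifP => Dn; last first.
  rewrite -[RHS](count_pred0 (lists k.+1 (ppairs n))); apply: eq_count => ab /=.
  by apply/negP => d; move: (d); have [p [r ->]] := rev_cons _ d; rewrite mE Dn.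
rewrite -size_filter -(size_map (fun x => rev (x.1 :: x.2))); apply: perm_size.
apply: uniq_perm; first exact/filter_uniq/uniq_lists/uniq_ppairs.
  rewrite map_inj_uniq ?uniq_msyms // => -[p r] [p' r'] /= /(can_inj revK) [-> ->] //.
move=> ab; rewrite mem_filter; apply/andP/mapP => [[d _]|[[p r] + ->]].
  move: (d); have [p [r ->]] := rev_cons _ d; rewrite mE Dn => m.
  by exists (p, r); rewrite ?mem_msyms.
rewrite mem_msyms mE Dn => m; split=> //; rewrite mem_lists all_rev size_rev /= eqSS.
move: m => /and5P [-> /and4P [/= pa pb _ _] cr _ /and3P [_ _ /eqP]].
rewrite /weight /= -/(weight r) => wn; rewrite chain_ppairs //; last by clear -wn; lia.
by rewrite andbT mem_ppairs; apply/andP; split; apply: partition_in_bseqs => //=; clear -wn; lia.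
Qed.

Lemma Durfee_countE k n :
  ((Durfee_count k.+1 n)%:R
   = \sum_(D < n.+1) if (D * D <= n)%N then rank_sum k D D D (fun=> 1) (n - D * D)%N
                     else 0)%R.
Proof.
rewrite /Durfee_count /ksyms -/(ppairs n) -sum1_count big_mkcond big_allpairs.
rewrite -[iota _ _]/(index_iota 0 n.+1) big_mkord natr_sum; apply: eq_bigr => D _.
rewrite -big_mkcond sum1_count count_kDurfee; case: ifP => // _.
by rewrite /rank_sum big_const_seq count_predT iter_addr_0.
Qed.

Theorem mainTheorem13 (k n : nat) :
  1 <= k -> ((Durfee_count k.+1 n)%:R = eta2k k n :> rat)%R.
Proof.
move=> _; rewrite Durfee_countE eta2kE sum_rank; apply: eq_bigr => D _.
by rewrite rank_sum_marked.
Qed.
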